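(* Let $\mathcal{M}$ be a semi-closed operad, with unique object $*$ and evaluation $\mathsf{ev}=\mathsf{ev}_{*,*}\in\mathcal{M}(2)$. Then $(( *,1),\mathsf{ev})$ is a planar $\lambda$-model in the multicategory $\mathsf{Split}(\mathcal{M})$, and there is an isomorphism of operads $$\mathcal{M}\;\cong\;R(\mathsf{Split}(\mathcal{M}),( *,1),\mathsf{ev}).$$
   Context: **Multicategories.** A multicategory $\mathcal{M}$ (planar, i.e. with no symmetric group actions) has a set $\mathcal{M}_0$ of objects, sets $\mathcal{M}(A_1,\ldots,A_n;B)$ of morphisms for all $n\ge 0$, associative composition $f\circ(g_1,\ldots,g_n)$, and unital identities $1_A\in\mathcal{M}(A;A)$. $A^n$ is the sequence of $n$ copies of $A$; the domain may be empty, as in $\mathcal{M}(;A)$; we write $f\circ g$ for $f\circ(g)$. A functor maps objects to objects and morphisms to morphisms of the corresponding type, preserving composition and identities. An operad is a multicategory with exactly one object, denoted $*$; write $\mathcal{M}(n)=\mathcal{M}( *^n;* )$ and $1=1_*$. **Semi-closed multicategory.** A multicategory $\mathcal{M}$ together with an object $[A,B]$ and a morphism $\mathsf{ev}_{A,B}\in\mathcal{M}([A,B],A;B)$ for all $A,B\in\mathcal{M}_0$, such that there exist mappings $\Lambda^\Gamma_{A,B}:\mathcal{M}(\Gamma,A;B)\to\mathcal{M}(\Gamma;[A,B])$ for all finite sequences $\Gamma$ of objects and all $A,B$ satisfying: $\mathsf{ev}_{A,B}\circ(\Lambda^\Gamma_{A,B}(f),1_A)=f$ for all $f\in\mathcal{M}(\Gamma,A;B)$;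 and for $\Gamma=A_1,\ldots,A_n$, $g\in\mathcal{M}(\Gamma,A;B)$ and $f_i\in\mathcal{M}(\Gamma_i;A_i)$, $\Lambda^{\Gamma_1,\ldots,\Gamma_n}_{A,B}(g\circ(f_1,\ldots,f_n,1_A))=\Lambda^\Gamma_{A,B}(g)\circ(f_1,\ldots,f_n)$. In a semi-closed operad necessarily $[*,*]=*$. **Idempotent splitting.** For a multicategory $\mathcal{M}$, $\mathsf{Split}(\mathcal{M})$ is the multicategory whose objects are pairs $(A,a)$ with $A\in\mathcal{M}_0$ and $a\in\mathcal{M}(A;A)$ with $a\circ a=a$; morphisms $(A_1,a_1),\ldots,(A_n,a_n)\to(B,b)$ are those $f\in\mathcal{M}(A_1,\ldots,A_n;B)$ with $b\circ f\circ(a_1,\ldots,a_n)=f$; the identity on $(A,a)$ is $a$; composition is that of $\mathcal{M}$. In particular $\mathsf{ev}\in\mathcal{M}(2)$ is a morphism in $\mathsf{Split}(\mathcal{M})(( *,1),( *,1);( *,1))$. **Applicative systems.** An applicative system $(A,\bullet)$ in $\mathcal{M}$ is an object $A$ with a morphism $\bullet\in\mathcal{M}(A,A;A)$. Define $\bullet^n\in\mathcal{M}(A^{n+1};A)$ by $\bullet^0=1_A$, $\bullet^{n+1}=\bullet\circ(\bullet^n,1_A)$. A morphism $f\in\mathcal{M}(A^n;A)$ is $(A,\bullet)$-computable if there is $a\in\mathcal{M}(;A)$ (a representative of $f$) with $\bullet^n\circ(a,1_A,\ldots,1_A)=f$. For $a,b\in\mathcal{M}(;A)$ write $ab=\bullet\circ(a,b)\in\mathcal{M}(;A)$,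 associating to the left. **Planar combinatory algebra.** An applicative system such that $\bullet\circ(1_A,\bullet)\in\mathcal{M}(A^3;A)$, $1_A$, and $\bullet\circ(1_A,a)$ for every $a\in\mathcal{M}(;A)$ are computable. Representatives of these are denoted $\mathsf{B}$, $\mathsf{I}$, $a^\bullet$ respectively. **Planar $\lambda$-algebra.** A planar combinatory algebra such that, for some choice of $\mathsf{B}$, $\mathsf{I}$ and $a^\bullet$, the following hold in $\mathcal{M}(;A)$ for all $a,b\in\mathcal{M}(;A)$: [P.1] $\mathsf{B}(\mathsf{B}(\mathsf{B}\mathsf{I}))\mathsf{B}=\mathsf{B}$; [P.2] $\mathsf{B}\mathsf{I}\mathsf{I}=\mathsf{I}$; [P.3] $\mathsf{B}\mathsf{I}a^\bullet=a^\bullet$; [P.4] $\mathsf{B}\mathsf{B}^\bullet(\mathsf{B}\mathsf{B}(\mathsf{B}\mathsf{B}\mathsf{B}))=\mathsf{B}(\mathsf{B}\mathsf{B})\mathsf{B}$; [P.5] $\mathsf{B}\mathsf{I}^\bullet\mathsf{B}=\mathsf{B}\mathsf{I}$; [P.6] $\mathsf{B}a^{\bullet\bullet}\mathsf{B}=\mathsf{B}(\mathsf{B}a^\bullet)\mathsf{B}$; [P.7] $(ab)^\bullet=\mathsf{B}b^\bullet(\mathsf{B}a^\bullet\mathsf{B})$. Such a choice is fixed whenever one works with a planar $\lambda$-algebra. Put $a*b=\mathsf{B}ab$, $a^{*0}=\mathsf{I}$, $a^{*(n+1)}=a^{*n}*a$. **Planar $\lambda$-model.** A planar $\lambda$-algebra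 (with such a choice of $\mathsf{B},\mathsf{I},a^\bullet$) that is weakly multi-extensional: for all $a,b\in\mathcal{M}(;A)$ and $n\in\mathbb{N}$, if $\bullet^n\circ(a,1_A,\ldots,1_A)=\bullet^n\circ(b,1_A,\ldots,1_A)$ in $\mathcal{M}(A^n;A)$, then $\mathsf{B}^{*n}\mathsf{I}a=\mathsf{B}^{*n}\mathsf{I}b$ in $\mathcal{M}(;A)$. **The operad $R$.** For a planar combinatory algebra $(A,\bullet)$ in a multicategory $\mathcal{N}$, $R(\mathcal{N},A,\bullet)$ is the operad whose morphisms of arity $n$ are the $(A,\bullet)$-computable morphisms in $\mathcal{N}(A^n;A)$, with composition and identity inherited from $\mathcal{N}$. *)

(* Defs.v *)
From mathcomp Require Import all_boot.
From Stdlib Require Import ProofIrrelevance.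

Set Implicit Arguments.
Unset Strict Implicit.
Unset Printing Implicit Defensive.

(* [hseq P [:: s1; ..; sn] [:: t1; ..; tn]] is the type of sequences
   (p1, .., pn) with pi : P si ti. *)
Inductive hseq (S T : Type) (P : S -> T -> Type) : seq S -> seq T -> Type :=
| hnil : hseq P [::] [::]
| hcons s t ss ts : P s t -> hseq P ss ts -> hseq P (s :: ss) (t :: ts).
Arguments hnil {S T P}.
Arguments hcons {S T P s t ss ts}.

Notation "[:h x ; .. ; y ]" := (hcons x .. (hcons y hnil) ..)
  (at level 0, format "[:h  x ;  .. ;  y ]").

Fixpoint hcat S T (P : S -> T -> Type) ss ts ss' ts'
    (ps : hseq P ss ts) (qs : hseq P ss' ts') : hseq P (ss ++ ss') (ts ++ ts') :=
  match ps with
  | hnil => qs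
  | hcons _ _ _ _ p ps => hcons p (hcat ps qs)
  end.

Fixpoint hflatten S T (P : S -> T -> Type) sss tss
    (pss : hseq (hseq P) sss tss) : hseq P (flatten sss) (flatten tss) :=
  match pss with
  | hnil => hnil
  | hcons _ _ _ _ ps pss => hcat ps (hflatten pss)
  end.

Fixpoint hmap S T S' T' (P : S -> T -> Type) (Q : S' -> T' -> Type)
    (phi : S -> S') (psi : T -> T')
    (F : forall s t, P s t -> Q (phi s) (psi t)) ss ts (ps : hseq P ss ts) :
    hseq Q (map phi ss) (map psi ts) :=
  match ps with
  | hnil => hnil
  | hcons _ _ _ _ p ps => hcons (F _ _ p) (hmap F ps)
  end.

Fixpoint hseq1 S T (P : S -> T -> Type) (phi : T -> S)
    (F : forall t, P (phi t) t) ts : hseq P (map phi ts) ts :=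
  match ts with
  | [::] => hnil
  | t :: ts => hcons (F t) (hseq1 F ts)
  end.

(* From the ps = (pi : P ti ui)_i and qs = (qi : Q si ti)_i, the sequence of the
   op pi qi. *)
Fixpoint hzip S T U S' (P : T -> U -> Type) (Q : S -> T -> Type)
    (phi : S -> S') (R : S' -> U -> Type)
    (op : forall s t u, P t u -> Q s t -> R (phi s) u) ts us
    (ps : hseq P ts us) {struct ps} :
    forall ss, hseq Q ss ts -> hseq R (map phi ss) us :=
  match ps in hseq _ ts us
    return forall ss, hseq Q ss ts -> hseq R (map phi ss) us with
  | hnil => fun ss qs =>
      match qs in hseq _ ss ts
        return if ts is [::] then hseq R (map phi ss) [::] else unit with
      | hnil => hnil
      | hcons _ _ _ _ _ _ => tt
      end
  | hcons t u ts us p ps => fun ss qs =>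
      match qs in hseq _ ss ts0
        return if ts0 is t :: ts then
          P t u -> (forall ss, hseq Q ss ts -> hseq R (map phi ss) us) ->
          hseq R (map phi ss) (u :: us) else unit with
      | hnil => tt
      | hcons _ _ _ _ q qs => fun p zip => hcons (op _ _ _ p q) (zip _ qs)
      end p (hzip op ps)
  end.

(* Equality of two morphisms whose domains are equal only propositionally;
   for convertible domains it is Leibniz equality (lemma heq_eq below). *)
Definition heq Ob (hom : seq Ob -> Ob -> Type) B Gam Gam'
    (f : hom Gam B) (g : hom Gam' B) : Prop :=
  existT (fun G => hom G B) Gam f = existT (fun G => hom G B) Gam' g.
Notation "f =~= g" := (heq f g) (at level 70, no associativity).

Definition castdom Ob (hom : seq Ob -> Ob -> Type) Gam Gam' B (e : Gam = Gam')
    (f : hom Gam B) : hom Gam' B :=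
  ecast G (hom G B) e f.

Record multicategory := Multicategory {
  mob :> Type;
  mhom : seq mob -> mob -> Type;
  mid : forall A, mhom [:: A] A;
  mcomp : forall Gams As B,
    mhom As B -> hseq mhom Gams As -> mhom (flatten Gams) B;
  mcompf1 : forall As B (f : mhom As B), mcomp f (hseq1 mid As) =~= f;
  mcomp1f : forall Gam B (f : mhom Gam B), mcomp (mid B) [:h f] =~= f;
  mcompA : forall Delss Gams As B (f : mhom As B) (gs : hseq mhom Gams As)
      (hss : hseq (hseq mhom) Delss Gams),
    mcomp (mcomp f gs) (hflatten hss) =~= mcomp f (hzip (@mcomp) gs hss)
}.
Arguments mhom {m}.
Arguments mid {m}.
Arguments mcomp {m Gams As B}.

Record operad := Operad {
  opcat :> multicategory;
  star : opcat;
  starP : forall A : opcat, A = star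
}.
Arguments star {o}.

Record mfunctor (M N : multicategory) := MFunctor {
  fob :> M -> N;
  fhom : forall Gam B, mhom Gam B -> mhom (map fob Gam) (fob B);
  fhom_id : forall A, fhom (mid A) = mid (fob A);
  fhom_comp : forall Gams As B (f : mhom As B) (gs : hseq mhom Gams As),
    fhom (mcomp f gs) =~= mcomp (fhom f) (hmap fhom gs)
}.

Definition mor (M : multicategory) := {p : seq M * M & mhom p.1 p.2}.

Definition fmor M N (F : mfunctor M N) (x : mor M) : mor N :=
  existT (fun p : seq N * N => mhom p.1 p.2)
    (map F (tag x).1, F (tag x).2) (fhom F (tagged x)).

Definition isomorphic (M N : multicategory) : Prop :=
  exists (F : mfunctor M N) (G : mfunctor N M),
    [/\ cancel F G, cancel G F, cancel (fmor F) (fmor G)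
      & cancel (fmor G) (fmor F)].

Record semiclosed (M : multicategory) := Semiclosed {
  ihom : M -> M -> M;
  ev : forall A B, mhom [:: ihom A B; A] B;
  curry_ex : exists curry : forall (Gam : seq M) (A B : M),
      mhom (Gam ++ [:: A]) B -> mhom Gam (ihom A B),
    (forall Gam A B (f : mhom (Gam ++ [:: A]) B),
       mcomp (ev A B) [:h curry Gam A B f; mid A] = f) /\
    (forall Gam Gams A B (g : mhom (Gam ++ [:: A]) B) (fs : hseq mhom Gams Gam),
       curry (flatten Gams) A B
         (castdom (flatten_cat Gams [:: [:: A]])
            (mcomp g (hcat fs [:h mid A]))) =
       mcomp (curry Gam A B g) fs)
}.

(* The evaluation of an operad, moved along the equality [*, *] = *. *)
Definition op_ev (M : operad) (C : semiclosed M) : mhom [:: star; star] star :=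
  ecast X (mhom [:: X; star] star) (starP (ihom C star star)) (ev C star star).

Definition hheq S T (P : S -> T -> Type) ss ts ss' ts'
    (ps : hseq P ss ts) (qs : hseq P ss' ts') : Prop :=
  existT (fun p => hseq P p.1 p.2) (ss, ts) ps =
  existT (fun p => hseq P p.1 p.2) (ss', ts') qs.

Lemma sigT_eqP I (P : I -> Type) x y (u : P x) (v : P y) :
  existT P x u = existT P y v -> exists e : x = y, ecast z (P z) e u = v.
Proof.
move=> E; exists (f_equal (@projT1 _ _) E).
exact: (match E as E in _ = z
  return ecast t (P t) (f_equal (@projT1 _ _) E) u = projT2 z with
  | erefl => erefl end).
Qed.

Lemma sigT_inj I (P : I -> Type) x (u v : P x) :
  existT P x u = existT P x v -> u = v.
Proof.
move=> /(@sigT_eqP I P x x u v) [e].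
by rewrite (proof_irrelevance _ e erefl).
Qed.

Lemma heq_eq Ob (hom : seq Ob -> Ob -> Type) B Gam (f g : hom Gam B) :
  f =~= g -> f = g.
Proof. exact: (@sigT_inj _ (fun G => hom G B)). Qed.

Lemma castdomE Ob (hom : seq Ob -> Ob -> Type) Gam Gam' B (e : Gam = Gam')
  (f : hom Gam B) : castdom e f =~= f.
Proof. by case: _ / e. Qed.

Lemma flatten_flatten T (sss : seq (seq (seq T))) :
  flatten (flatten sss) = flatten (map flatten sss).
Proof. by elim: sss => //= ss sss IH; rewrite flatten_cat IH. Qed.

Lemma heqP Ob (hom : seq Ob -> Ob -> Type) B Gam Gam'
    (f : hom Gam B) (g : hom Gam' B) :
  f =~= g -> exists e : Gam = Gam', castdom e f = g.
Proof. exact: (@sigT_eqP _ (fun G => hom G B)). Qed.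

Lemma hheqP S T (P : S -> T -> Type) ss ts ss' ts'
    (ps : hseq P ss ts) (qs : hseq P ss' ts') :
  hheq ps qs ->
  exists (e : ss = ss') (d : ts = ts'),
    ecast x (hseq P ss' x) d (ecast x (hseq P x ts) e ps) = qs.
Proof.
move=> /(@sigT_eqP _ (fun p => hseq P p.1 p.2) (ss, ts) (ss', ts') ps qs) [e H].
case: (e) => e1 e2; exists e1, e2; move: e qs H.
case: _ / e1; case: _ / e2 => e qs.
by rewrite (proof_irrelevance _ e erefl).
Qed.

Lemma hcons_hheq S T (P : S -> T -> Type) s t (p : P s t) ss ts ss' ts'
  (ps : hseq P ss ts) (ps' : hseq P ss' ts') :
  hheq ps ps' -> hheq (hcons p ps) (hcons p ps').
Proof.
move=> /hheqP [e [d H]]; move: ps' H.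
by case: _ / d; case: _ / e => /= ps' ->.
Qed.

Lemma hseq_consP S T (P : S -> T -> Type) t ts
    (K : forall ss, hseq P ss (t :: ts) -> Prop) :
  (forall s ss p (ps : hseq P ss ts), K (s :: ss) (hcons p ps)) ->
  forall ss ps, K ss ps.
Proof.
move=> HK ss ps.
exact: (match ps as ps in hseq _ ss ts0
    return match ts0 return hseq P ss ts0 -> Prop with
      | [::] => fun _ => True
      | t :: ts => fun ps => forall K : forall ss, hseq P ss (t :: ts) -> Prop,
          (forall s ss p (ps : hseq P ss ts), K (s :: ss) (hcons p ps)) -> K ss ps
      end ps with
  | hnil => I
  | hcons _ _ _ _ p ps => fun K HK => HK _ _ p ps
  end K HK).
Qed.

Lemma hseq_nilP S T (P : S -> T -> Type)
    (K : forall ss, hseq P ss [::] -> Prop) :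
  K [::] hnil -> forall ss ps, K ss ps.
Proof.
move=> HK ss ps.
exact: (match ps as ps in hseq _ ss ts0
    return match ts0 return hseq P ss ts0 -> Prop with
      | [::] => fun ps => forall K : forall ss, hseq P ss [::] -> Prop,
          K [::] hnil -> K ss ps
      | t :: ts => fun _ => True
      end ps with
  | hnil => fun K HK => HK
  | hcons _ _ _ _ p ps => I
  end K HK).
Qed.

Fixpoint hsing S T (P : S -> T -> Type) ss ts (ps : hseq P ss ts) :
    hseq (hseq P) [seq [:: s] | s <- ss] [seq [:: t] | t <- ts] :=
  match ps with
  | hnil => hnil
  | hcons _ _ _ _ p ps => hcons [:h p] (hsing ps)
  end.

Lemma hflatten_sing S T (P : S -> T -> Type) ss ts (ps : hseq P ss ts) :
  hheq (hflatten (hsing ps)) ps.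
Proof. by elim: ps => //= s t {}ss {}ts p ps IH; apply: hcons_hheq. Qed.

Lemma hcat0 S T (P : S -> T -> Type) ss ts (ps : hseq P ss ts) :
  hheq (hcat ps hnil) ps.
Proof. by elim: ps => //= s t {}ss {}ts p ps IH; apply: hcons_hheq. Qed.

Lemma hcat_hheq S T (P : S -> T -> Type) ss ts (ps : hseq P ss ts) ss1 ts1
    (qs : hseq P ss1 ts1) ss2 ts2 (rs : hseq P ss2 ts2) :
  hheq qs rs -> hheq (hcat ps qs) (hcat ps rs).
Proof. by move=> H; elim: ps => //= s t {}ss {}ts p ps IH; apply: hcons_hheq. Qed.

Lemma hmap_cat S T S' T' (P : S -> T -> Type) (Q : S' -> T' -> Type)
    (phi : S -> S') (psi : T -> T')
    (F : forall s t, P s t -> Q (phi s) (psi t)) ss ts (ps : hseq P ss ts)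
    ss' ts' (qs : hseq P ss' ts') :
  hheq (hmap F (hcat ps qs)) (hcat (hmap F ps) (hmap F qs)).
Proof. by elim: ps => //= s t {}ss {}ts p ps IH; apply: hcons_hheq. Qed.

Lemma hmap_flatten S T S' T' (P : S -> T -> Type) (Q : S' -> T' -> Type)
    (phi : S -> S') (psi : T -> T')
    (F : forall s t, P s t -> Q (phi s) (psi t)) sss tss
    (pss : hseq (hseq P) sss tss) :
  hheq (hmap F (hflatten pss)) 
    (hflatten (hmap (P := hseq P) (Q := hseq Q) (phi := map phi)
       (psi := map psi) (fun _ _ qs => hmap F qs) pss)).
Proof.
elim: pss => //= ss ts {}sss {}tss ps pss IH.
by apply: (etrans (hmap_cat _ _ _)); apply: hcat_hheq.
Qed.

Section Calculus.
Variable M : multicategory.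
Implicit Types (A B : M) (Gam As : seq M) (Gams : seq (seq M)).

Lemma mcomp_heq As As' B (f : mhom As B) (f' : mhom As' B) Gams Gams'
  (gs : hseq mhom Gams As) (gs' : hseq mhom Gams' As') :
  f =~= f' -> hheq gs gs' -> mcomp f gs =~= mcomp f' gs'.
Proof.
move=> Hf /hheqP [e [d H]]; move: gs' H f' Hf.
destruct d, e => gs' /= <- f' Hf.
by rewrite (heq_eq Hf).
Qed.

Lemma hcons_mheq Gam Gam' A (g : mhom Gam A) (g' : mhom Gam' A) Gams Gams' As As'
  (gs : hseq mhom Gams As) (gs' : hseq mhom Gams' As') :
  g =~= g' -> hheq gs gs' -> hheq (hcons g gs) (hcons g' gs').
Proof.
move=> Hg H; have [c Hc] := heqP Hg.
move: g' {Hg} Hc; destruct c => g' /= <-; exact: hcons_hheq.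
Qed.

Lemma mcomp1_heq A B (f : mhom [:: A] B) Gam Gam' (g : mhom Gam A)
    (g' : mhom Gam' A) :
  g =~= g' -> mcomp f [:h g] =~= mcomp f [:h g'].
Proof. by move=> H; apply: mcomp_heq => //; apply: hcons_mheq. Qed.


Lemma mcomp2_heq A A' B (f : mhom [:: A; A'] B) Gam Gam' Del Del'
    (g : mhom Gam A) (g' : mhom Gam' A) (h : mhom Del A') (h' : mhom Del' A') :
  g =~= g' -> h =~= h' -> mcomp f [:h g; h] =~= mcomp f [:h g'; h'].
Proof.
by move=> Hg Hh; apply: mcomp_heq => //; apply: hcons_mheq => //;
   apply: hcons_mheq.
Qed.

Lemma mcompA1 A B (f : mhom [:: A] B) Gam (g : mhom Gam A) Gams
    (hs : hseq mhom Gams Gam) :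
  mcomp (mcomp f [:h g]) (hcat hs hnil) =~= mcomp f [:h mcomp g hs].
Proof. exact: (mcompA f [:h g] [:h hs]). Qed.

Lemma mcompA2 A A' B (f : mhom [:: A; A'] B) Gam Gam' (g : mhom Gam A)
    (g' : mhom Gam' A') Gams Gams'
    (hs : hseq mhom Gams Gam) (hs' : hseq mhom Gams' Gam') :
  mcomp (mcomp f [:h g; g']) (hcat hs (hcat hs' hnil)) =~=
  mcomp f [:h mcomp g hs; mcomp g' hs'].
Proof. exact: (mcompA f [:h g; g'] [:h hs; hs']). Qed.

End Calculus.

Section Split.
Variable M : multicategory.

Record split_ob := SplitOb {
  so_ob : M;
  so_idem : mhom [:: so_ob] so_ob;
  so_idemP : mcomp so_idem [:h so_idem] = so_idem
}.

Fixpoint idems (Gam : seq split_ob) :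
    hseq mhom [seq [:: A] | A <- map so_ob Gam] (map so_ob Gam) :=
  match Gam with
  | [::] => hnil
  | X :: Gam => hcons (so_idem X) (idems Gam)
  end.

Definition split_mor Gam B (f : mhom (map so_ob Gam) (so_ob B)) : Prop :=
  mcomp (so_idem B) [:h mcomp f (idems Gam)] =~= f.

Definition split_hom (Gam : seq split_ob) (B : split_ob) : Type :=
  {f : mhom (map so_ob Gam) (so_ob B) | split_mor f}.

Lemma hzip_idems (Gam : seq split_ob) :
  hheq (hzip (@mcomp M) (idems Gam) (hsing (idems Gam))) (idems Gam).
Proof.
elim: Gam => //= X Gam IH; apply: hcons_mheq => //.
by rewrite so_idemP.
Qed.

Fixpoint idemss (Gams : seq (seq split_ob)) :
    hseq (hseq mhom) [seq [seq [:: A] | A <- map so_ob Gam] | Gam <- Gams]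
      (map (map so_ob) Gams) :=
  match Gams with
  | [::] => hnil
  | Gam :: Gams => hcons (idems Gam) (idemss Gams)
  end.

Lemma idems_cat Gam Gam' :
  hheq (idems (Gam ++ Gam')) (hcat (idems Gam) (idems Gam')).
Proof. by elim: Gam => //= X Gam IH; apply: hcons_hheq. Qed.

Lemma idems_flatten Gams : hheq (idems (flatten Gams)) (hflatten (idemss Gams)).
Proof.
elim: Gams => //= Gam Gams IH.
by apply: (etrans (idems_cat _ _)); apply: hcat_hheq.
Qed.

Lemma split_absr Gam B (f : split_hom Gam B) :
  mcomp (sval f) (idems Gam) =~= sval f.
Proof.
case: f => f /= Hf.
have E : mcomp (mcomp f (idems Gam)) (hflatten (hsing (idems Gam)))
     =~= mcomp f (idems Gam).
  apply: (etrans (mcompA _ _ _)); apply: mcomp_heq => //; exact: hzip_idems.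
apply: (etrans _ Hf); apply: (etrans _ (mcomp1_heq (so_idem B) E)).
apply: etrans (mcompA1 _ _ _); apply: mcomp_heq; first exact: (esym Hf).
apply: esym; apply: (etrans (hcat0 _)); exact: hflatten_sing.
Qed.

Lemma split_absl Gam B (f : split_hom Gam B) :
  mcomp (so_idem B) [:h sval f] =~= sval f.
Proof.
apply: etrans (svalP f); apply: mcomp1_heq; exact: (esym (split_absr f)).
Qed.

Lemma split_homP Gam B (f : mhom (map so_ob Gam) (so_ob B)) :
  mcomp f (idems Gam) =~= f -> mcomp (so_idem B) [:h f] =~= f ->
  split_mor f.
Proof. by move=> Hr Hl; apply: (etrans _ Hl); apply: mcomp1_heq. Qed.

Definition split_vals Gams As (gs : hseq split_hom Gams As) :
    hseq mhom (map (map so_ob) Gams) (map so_ob As) :=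
  hmap (fun Gam B (f : split_hom Gam B) => sval f) gs.

Lemma split_id_subproof X : @split_mor [:: X] X (so_idem X).
Proof. by rewrite /split_mor /= !so_idemP. Qed.

Definition split_id X : split_hom [:: X] X :=
  exist (@split_mor [:: X] X) (so_idem X) (split_id_subproof X).

Lemma split_comp_subproof Gams As B (f : split_hom As B)
    (gs : hseq split_hom Gams As) :
  @split_mor (flatten Gams) B
    (castdom (esym (map_flatten so_ob Gams)) (mcomp (sval f) (split_vals gs))).
Proof.
set fg := castdom _ _.
have E : fg =~= mcomp (sval f) (split_vals gs) by apply: castdomE.
apply: split_homP.
- apply: etrans (esym E).
  apply: (etrans (mcomp_heq E (idems_flatten _))).
  apply: (etrans (mcompA _ _ _)); apply: mcomp_heq => //.
  elim: gs {fg E f} => //= Gam A {}Gams {}As g gs IH.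
  by apply: hcons_mheq => //; apply: split_absr.
- apply: etrans (esym E); apply: (etrans (mcomp1_heq _ E)).
  apply: (etrans (esym (mcompA1 _ _ _))).
  by apply: mcomp_heq; [apply: split_absl | apply: hcat0].
Qed.

Definition split_comp Gams As B (f : split_hom As B)
    (gs : hseq split_hom Gams As) : split_hom (flatten Gams) B :=
  exist (@split_mor (flatten Gams) B)
    (castdom (esym (map_flatten so_ob Gams)) (mcomp (sval f) (split_vals gs)))
    (split_comp_subproof f gs).

Lemma split_heq Gam Gam' B (f : split_hom Gam B) (g : split_hom Gam' B) :
  Gam = Gam' -> sval f =~= sval g -> f =~= g.
Proof.
move=> e; destruct e; case: f g => f Hf [g Hg] /= H.
have E := heq_eq H; destruct E.
by rewrite (proof_irrelevance _ Hf Hg).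
Qed.

Lemma split_compf1 As B (f : split_hom As B) :
  split_comp f (hseq1 split_id As) =~= f.
Proof.
apply: split_heq; first exact: flatten_seq1.
apply: (etrans (castdomE _ _)); apply: etrans (split_absr f).
apply: mcomp_heq => //.
by elim: As {f} => //= X As IH; apply: hcons_hheq.
Qed.

Lemma split_comp1f Gam B (f : split_hom Gam B) :
  split_comp (split_id B) [:h f] =~= f.
Proof.
apply: split_heq; first exact: cats0.
by apply: (etrans (castdomE _ _)); apply: split_absl.
Qed.

Lemma split_compA Delss Gams As B (f : split_hom As B)
    (gs : hseq split_hom Gams As) (hss : hseq (hseq split_hom) Delss Gams) :
  split_comp (split_comp f gs) (hflatten hss) =~=
  split_comp f (hzip split_comp gs hss).
Proof.
apply: split_heq; first exact: flatten_flatten.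
apply: (etrans (castdomE _ _)); apply: etrans (esym (castdomE _ _)).
apply: (etrans (mcomp_heq (castdomE _ _) (hmap_flatten _ _))).
apply: (etrans (mcompA _ _ _)); apply: mcomp_heq => //.
elim: gs Delss hss {f} => [|Gam A {}Gams {}As g gs IH] Delss hss.
  by move: Delss hss; apply: hseq_nilP.
move: Delss hss; apply: hseq_consP => Dels Delss hs hss /=.
apply: hcons_mheq; last exact: IH.
exact: (esym (castdomE _ _)).
Qed.

Definition split : multicategory :=
  Multicategory split_compf1 split_comp1f split_compA.

End Split.

Lemma nseq_cat1 T n (x : T) : nseq n x ++ [:: x] = nseq n.+1 x.
Proof. by elim: n => //= n ->. Qed.

Section Applicative.
Variables (N : multicategory) (A : N) (app : mhom [:: A; A] A).

Fixpoint bullet n : mhom (nseq n.+1 A) A :=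
  match n with
  | 0 => mid A
  | n.+1 => castdom (nseq_cat1 n.+1 A) (mcomp app [:h bullet n; mid A])
  end.

(* The operation (x1, .., xn) |-> a x1 .. xn represented by a. *)
Definition repr_op n (a : mhom [::] A) : mhom (nseq n A) A :=
  castdom (flatten_seq1 (nseq n A))
    (mcomp (bullet n) (hcons a (hseq1 mid (nseq n A)))).

Definition computable n (f : mhom (nseq n A) A) : Prop :=
  exists a, repr_op n a = f.

Definition capp (a b : mhom [::] A) : mhom [::] A := mcomp app [:h a; b].

Record planar_combinatory_algebra : Prop := PlanarCombinatoryAlgebra {
  pca_B : @computable 3 (mcomp app [:h mid A; app]);
  pca_I : @computable 1 (mid A);
  pca_dag : forall a : mhom [::] A, @computable 1 (mcomp app [:h mid A; a])
}.

Record combinators := Combinators {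
  cB : mhom [::] A;
  cI : mhom [::] A;
  cdag : mhom [::] A -> mhom [::] A;
  cBP : repr_op 3 cB = mcomp app [:h mid A; app];
  cIP : repr_op 1 cI = mid A;
  cdagP : forall a, repr_op 1 (cdag a) = mcomp app [:h mid A; a]
}.

Local Notation "a $ b" := (capp a b) (at level 40, left associativity).

Record lambda_axioms (c : combinators) : Prop := LambdaAxioms {
  axP1 : cB c $ (cB c $ (cB c $ cI c)) $ cB c = cB c;
  axP2 : cB c $ cI c $ cI c = cI c;
  axP3 : forall a, cB c $ cI c $ cdag c a = cdag c a;
  axP4 : cB c $ cdag c (cB c) $ (cB c $ cB c $ (cB c $ cB c $ cB c))
         = cB c $ (cB c $ cB c) $ cB c;
  axP5 : cB c $ cdag c (cI c) $ cB c = cB c $ cI c;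
  axP6 : forall a, cB c $ cdag c (cdag c a) $ cB c
         = cB c $ (cB c $ cdag c a) $ cB c;
  axP7 : forall a b, cdag c (a $ b)
         = cB c $ cdag c b $ (cB c $ cdag c a $ cB c)
}.

Definition planar_lambda_algebra : Prop :=
  planar_combinatory_algebra /\ exists c : combinators, lambda_axioms c.

Definition cstar (c : combinators) (a b : mhom [::] A) := cB c $ a $ b.

Fixpoint cstarn (c : combinators) (a : mhom [::] A) n : mhom [::] A :=
  if n is n.+1 then cstar c (cstarn c a n) a else cI c.

Definition weakly_multi_extensional (c : combinators) : Prop :=
  forall (a b : mhom [::] A) n, repr_op n a = repr_op n b ->
    cstarn c (cB c) n $ cI c $ a = cstarn c (cB c) n $ cI c $ b.

Record planar_lambda_model : Prop := PlanarLambdaModel {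
  plm_pca : planar_combinatory_algebra;
  plm_ext : exists c : combinators, lambda_axioms c /\ weakly_multi_extensional c
}.

Definition happ n Gam (x : mhom Gam A) Gams (gs : hseq mhom Gams (nseq n A)) :=
  mcomp (bullet n) (hcons x gs).
Definition ids n := hseq1 mid (nseq n A).

Definition tcomputable Gam (x : mhom Gam A) : Prop :=
  exists n (a : mhom [::] A), happ a (ids n) =~= x.

Lemma tcomputable_heq Gam Gam' (x : mhom Gam A) (y : mhom Gam' A) :
  x =~= y -> tcomputable x -> tcomputable y.
Proof. by move=> E [n [a H]]; exists n, a; apply: (etrans H). Qed.

Lemma computableE n (f : mhom (nseq n A) A) : computable f <-> tcomputable f.
Proof.
split=> [[a <-]|[m [a H]]]; first by exists n, a; apply/esym/castdomE.
have e : m = n.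
  have [d _] := heqP H; move: (f_equal size d).
  by rewrite /= flatten_seq1 !size_nseq.
move: H; rewrite e => H; exists a; apply: (heq_eq (hom := mhom)).
by apply: (etrans (castdomE _ _)).
Qed.

Lemma hseq1_nseq_snoc n :
  hheq (hcat (ids n) [:h mid A]) (ids n.+1).
Proof. by elim: n => //= n IH; apply: hcons_hheq. Qed.

Lemma hcat_hheql S T (P : S -> T -> Type) ss ts (ps : hseq P ss ts) ss' ts'
  (ps' : hseq P ss' ts') ss1 ts1 (qs : hseq P ss1 ts1) :
  hheq ps ps' -> hheq (hcat ps qs) (hcat ps' qs).
Proof.
move=> /hheqP [e [d H]]; move: ps' H.
by destruct d, e => /= ps' <-.
Qed.

Lemma bulletSr n : bullet n.+1 =~= mcomp (bullet n) (hcons app (ids n)).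
Proof.
elim: n => [|n IH].
  apply: (etrans (castdomE _ _)).
  apply: etrans (esym (mcomp1f app)).
  exact: (mcompf1 app).
apply: (etrans (castdomE _ _)).
apply: (etrans (mcomp2_heq _ IH (esym (mcomp1f (mid A))))).
apply: (etrans (esym (mcompA2 _ _ _ _ _))).
apply: mcomp_heq; first exact/esym/castdomE.
by apply: hcons_hheq; apply: hseq1_nseq_snoc.
Qed.

Lemma happ0 Gam (x : mhom Gam A) : @happ 0 _ x _ hnil =~= x.
Proof. exact: mcomp1f. Qed.

Lemma hzip_ids (As : seq N) Gams (gs : hseq mhom Gams As) :
  hheq (hzip (@mcomp N) (hseq1 mid As) (hsing gs)) gs.
Proof.
elim: gs => //= Gam B {}Gams {}As g gs IH.
by apply: hcons_mheq => //; apply: mcomp1f.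
Qed.

Lemma happS n Gam (x : mhom Gam A) Del (g : mhom Del A) Gams
    (gs : hseq mhom Gams (nseq n A)) :
  @happ n.+1 _ x _ (hcons g gs) =~= happ (mcomp app [:h x; g]) gs.
Proof.
have E : hheq (hcons x (hcons g gs))
   (hflatten (hcons (P := hseq mhom) [:h x; g] (hsing gs))).
  rewrite /=; apply: hcons_hheq; apply: hcons_hheq; apply: esym.
  exact: hflatten_sing.
apply: (etrans (mcomp_heq (bulletSr n) E)).
apply: (etrans (mcompA _ _ _)); apply: mcomp_heq => //=.
by apply: hcons_hheq; apply: hzip_ids.
Qed.

Lemma happ_snoc n Gam (x : mhom Gam A) :
  mcomp app [:h happ x (ids n); mid A] =~= happ x (ids n.+1).
Proof.
apply: (etrans (mcomp2_heq _ erefl (esym (mcomp1f (mid A))))).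
apply: (etrans (esym (mcompA2 _ _ _ _ _))).
apply: mcomp_heq; first exact/esym/castdomE.
by apply: hcons_hheq; apply: hseq1_nseq_snoc.
Qed.

Lemma tcomputable_snoc Gam (x : mhom Gam A) :
  tcomputable x -> tcomputable (mcomp app [:h x; mid A]).
Proof.
case=> n [a H]; exists n.+1, a; apply: etrans (mcomp2_heq _ H erefl).
exact/esym/happ_snoc.
Qed.

Lemma tcomputable0 (a : mhom [::] A) : tcomputable a.
Proof. by exists 0, a; apply: happ0. Qed.

Hypothesis pca : planar_combinatory_algebra.

Lemma repr_comp n (a : mhom [::] A) (f : mhom (nseq n A) A) Gams
    (gs : hseq mhom Gams (nseq n A)) :
  happ a (ids n) =~= f -> mcomp f gs =~= happ a gs.
Proof.
move=> H.
have E : hheq gs (hflatten (hcons (P := hseq mhom) hnil (hsing gs))).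
  exact/esym/hflatten_sing.
apply: (etrans (mcomp_heq (esym H) E)).
apply: (etrans (mcompA _ _ _)); apply: mcomp_heq => //.
apply: hcons_mheq; last exact: hzip_ids.
exact: (mcompf1 a).
Qed.

Lemma pca_assoc : exists b : mhom [::] A, forall Gam (x : mhom Gam A)
    Del (y : mhom Del A) Xi (z : mhom Xi A),
  mcomp app [:h x; mcomp app [:h y; z]] =~=
  mcomp app [:h mcomp app [:h mcomp app [:h b; x]; y]; z].
Proof.
case: (pca_B pca) => b Hb; exists b => Gam x Del y Xi z.
have H : @happ 3 _ b _ (ids 3) =~= mcomp app [:h mid A; app].
  by rewrite -Hb; apply/esym/castdomE.
apply: etrans (happ0 _); apply: etrans (happS _ _ _).
apply: etrans (happS _ _ _); apply: etrans (happS _ _ _).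
apply: etrans (repr_comp _ H).
apply: esym; apply: (etrans (mcompA2 app (mid A) app [:h x] [:h y; z])).
by apply: mcomp2_heq => //; apply: mcomp1f.
Qed.

Lemma pca_swap (a : mhom [::] A) : exists d : mhom [::] A,
  forall Gam (x : mhom Gam A), mcomp app [:h x; a] =~= mcomp app [:h d; x].
Proof.
case: (pca_dag pca a) => d Hd; exists d => Gam x.
have H : @happ 1 _ d _ (ids 1) =~= mcomp app [:h mid A; a].
  by rewrite -Hd; apply/esym/castdomE.
apply: etrans (happ0 _); apply: etrans (happS _ _ _).
apply: etrans (repr_comp _ H).
apply: esym; apply: (etrans (mcompA2 app (mid A) a [:h x] hnil)).
apply: mcomp2_heq; [exact: mcomp1f | exact: (mcompf1 a)].
Qed.

Lemma tcomputable_appl (e : mhom [::] A) Gam (f : mhom Gam A) :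
  tcomputable f -> tcomputable (mcomp app [:h e; f]).
Proof.
case=> n [a H]; move: e; elim: n Gam f H => [|n IH] Gam f H e.
  apply: tcomputable_heq (tcomputable0 (mcomp app [:h e; a])).
  by apply: (mcomp2_heq app (erefl : e =~= e) (etrans (esym (happ0 a)) H)).
have [b Hb] := pca_assoc.
apply: tcomputable_heq (tcomputable_snoc (IH _ _ erefl (mcomp app [:h b; e]))).
apply: (etrans (esym (Hb _ e _ (happ a (ids n)) _ (mid A)))).
exact: (mcomp2_heq app (erefl : e =~= e) (etrans (happ_snoc n a) H)).
Qed.

Lemma tcomputable_app Gam (f : mhom Gam A) Del (g : mhom Del A) :
  tcomputable f -> tcomputable g -> tcomputable (mcomp app [:h f; g]).
Proof.
move=> Hf [n [a H]]; elim: n Gam f Hf Del g H => [|n IH] Gam f Hf Del g H.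
  have [d Hd] := pca_swap a.
  apply: tcomputable_heq (tcomputable_appl d Hf).
  apply: (etrans (esym (Hd _ _))); apply: mcomp2_heq => //.
  by apply: (etrans _ H); apply/esym/happ0.
have [b Hb] := pca_assoc.
apply: tcomputable_heq
  (tcomputable_snoc (IH _ _ (tcomputable_appl b Hf) _ _ erefl)).
apply: (etrans (esym (Hb _ f _ (happ a (ids n)) _ (mid A)))).
exact: (mcomp2_heq app (erefl : f =~= f) (etrans (happ_snoc n a) H)).
Qed.

(* The operad of computable operations: as there is a single object, a source
   Gam : seq unit stands for A ^ (size Gam). *)

Definition R_hom (Gam : seq unit) (B : unit) : Type :=
  {f : mhom (nseq (size Gam) A) A | computable f}.

Fixpoint R_vals Gams As (gs : hseq R_hom Gams As) :
    hseq mhom [seq nseq (size Gam) A | Gam <- Gams] (nseq (size As) A) :=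
  match gs with
  | hnil => hnil
  | hcons _ _ _ _ g gs => hcons (sval g) (R_vals gs)
  end.

Lemma flatten_nseq (Gams : seq (seq unit)) :
  flatten [seq nseq (size Gam) A | Gam <- Gams] = nseq (size (flatten Gams)) A.
Proof. by elim: Gams => //= G Gams ->; rewrite size_cat nseqD. Qed.

Lemma R_comp_subproof Gams As B (f : R_hom As B) (gs : hseq R_hom Gams As) :
  computable (castdom (flatten_nseq Gams) (mcomp (sval f) (R_vals gs))).
Proof.
apply/computableE; apply: tcomputable_heq (esym (castdomE _ _)) _.
case: f => f /= [a Hf].
have H : happ a (ids (size As)) =~= f.
  by rewrite -Hf; apply/esym/castdomE.
apply: tcomputable_heq (esym (repr_comp _ H)) _.
elim: gs [::] a (tcomputable0 a) {f Hf H} => [|Gam A' {}Gams {}As g gs IH] Del x Hx.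
  exact: tcomputable_heq (esym (happ0 x)) Hx.
apply: tcomputable_heq (esym (happS _ _ _)) _; apply: IH.
apply: tcomputable_app Hx _; apply/computableE; exact: svalP.
Qed.

Definition R_id (B : unit) : R_hom [:: B] B :=
  exist (@computable 1) (mid A) (pca_I pca).

Definition R_comp Gams As B (f : R_hom As B) (gs : hseq R_hom Gams As) :
    R_hom (flatten Gams) B :=
  exist (@computable _) (castdom (flatten_nseq Gams) (mcomp (sval f) (R_vals gs)))
    (R_comp_subproof f gs).

Lemma R_heq Gam Gam' B (f : R_hom Gam B) (g : R_hom Gam' B) :
  Gam = Gam' -> sval f =~= sval g -> f =~= g.
Proof.
move=> e; destruct e; case: f g => f Hf [g Hg] /= H.
have E := heq_eq H; destruct E.
by rewrite (proof_irrelevance _ Hf Hg).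
Qed.

Lemma R_compf1 As B (f : R_hom As B) : R_comp f (hseq1 R_id As) =~= f.
Proof.
apply: R_heq; first exact: flatten_seq1.
apply: (etrans (castdomE _ _)); apply: etrans (mcompf1 (sval f)).
apply: mcomp_heq => //.
by elim: As {f} => //= X As IH; apply: hcons_hheq.
Qed.

Lemma R_comp1f Gam B (f : R_hom Gam B) : R_comp (R_id B) [:h f] =~= f.
Proof.
apply: R_heq; first exact: cats0.
by apply: (etrans (castdomE _ _)); apply: mcomp1f.
Qed.

Fixpoint R_valss Delss Gams (hss : hseq (hseq R_hom) Delss Gams) :
    hseq (hseq mhom) [seq [seq nseq (size Del) A | Del <- Dels] | Dels <- Delss]
      [seq nseq (size Gam) A | Gam <- Gams] :=
  match hss with
  | hnil => hnil
  | hcons _ _ _ _ hs hss => hcons (R_vals hs) (R_valss hss)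
  end.

Lemma R_vals_flatten Delss Gams (hss : hseq (hseq R_hom) Delss Gams) :
  hheq (R_vals (hflatten hss)) (hflatten (R_valss hss)).
Proof.
elim: hss => //= Dels Gam {}Delss {}Gams hs hss IH.
apply: etrans (hcat_hheq _ IH).
by elim: hs => //= Del B {}Dels {}Gam h hs IHh; apply: hcons_hheq.
Qed.

Lemma R_compA Delss Gams As B (f : R_hom As B) (gs : hseq R_hom Gams As)
    (hss : hseq (hseq R_hom) Delss Gams) :
  R_comp (R_comp f gs) (hflatten hss) =~= R_comp f (hzip R_comp gs hss).
Proof.
apply: R_heq; first exact: flatten_flatten.
apply: (etrans (castdomE _ _)); apply: etrans (esym (castdomE _ _)).
apply: (etrans (mcomp_heq (castdomE _ _) (R_vals_flatten _))).
apply: (etrans (mcompA _ _ _)); apply: mcomp_heq => //.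
elim: gs Delss hss {f} => [|Gam A' {}Gams {}As g gs IH] Delss hss.
  by move: Delss hss; apply: hseq_nilP.
move: Delss hss; apply: hseq_consP => Dels Delss hs hss /=.
apply: hcons_mheq; last exact: IH.
exact: (esym (castdomE _ _)).
Qed.

Definition R_multicategory : multicategory :=
  Multicategory R_compf1 R_comp1f R_compA.

Lemma R_starP (B : R_multicategory) : B = tt.
Proof. by case: B. Qed.

Definition R_operad : operad := Operad R_starP.

End Applicative.

Section SplitStar.
Variables (M : operad) (C : semiclosed M).

Lemma split_star_subproof :
  mcomp (mid star) [:h mid star] = mid (star : M).
Proof. exact/(heq_eq (hom := mhom))/mcomp1f. Qed.

Definition split_star : split M := SplitOb split_star_subproof.

Lemma split_ev_subproof :
  @split_mor M [:: split_star; split_star] split_star (op_ev C).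
Proof.
apply: split_homP; last exact: mcomp1f.
exact: (mcompf1 (op_ev C)).
Qed.

Definition split_ev : mhom [:: split_star; split_star] split_star :=
  exist (@split_mor M [:: split_star; split_star] split_star) (op_ev C)
    split_ev_subproof.

End SplitStar.

(* Main.v *)
Require Import Defs.
From mathcomp Require Import all_boot.
From Stdlib Require Import ProofIrrelevance.

Set Implicit Arguments.
Unset Strict Implicit.
Unset Printing Implicit Defensive.

(** The element [Lam^n f] represents [f], so every operation of a semi-closed
    operad is computable; since moreover ( *, 1) carries all operations
    of M in Split(M), the operad R is M itself up to reindexing.

    For the axioms, naturality of Lam makes eta = Lam(ev) an idempotent that
    fixes every Lam(f) and identifies x and y as soon as x 1 = y 1.  Hence two
    terms fixed by eta are equal when they agree after application to the
    identity.  Each of P.1-P.7 follows by stripping its leading abstractions in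
    this way, and weak multi-extensionality by induction on n from
    B^{*(n+1)} f a = B^{*n} (B f) a. *)

(** * Planar lambda-models from an abstraction operator *)

Section Abstraction.
Variables (N : multicategory) (A : N) (app : mhom [:: A; A] A).

(* [eta] stands for Lam(ev); the naturality of Lam enters only through
   [eta_lam] and [eta_ext]. *)
Record abstraction := Abstraction {
  lam : forall Gam, mhom (Gam ++ [:: A]) A -> mhom Gam A;
  eta : mhom [:: A] A;
  lam_beta : forall Gam (f : mhom (Gam ++ [:: A]) A),
    mcomp app [:h lam f; mid A] = f;
  eta_lam : forall Gam (f : mhom (Gam ++ [:: A]) A),
    mcomp eta [:h lam f] =~= lam f;
  eta_ext : forall Gam (x y : mhom Gam A),
    mcomp app [:h x; mid A] = mcomp app [:h y; mid A] ->
    mcomp eta [:h x] = mcomp eta [:h y]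
}.

(* Packing a morphism with its domain turns [=~=] into Leibniz equality, so that
   the equations below can be used for rewriting. *)
Definition term := {Gam : seq N & mhom Gam A}.
Definition pack Gam (x : mhom Gam A) : term := existT _ Gam x.
Definition tapp (t u : term) : term :=
  pack (mcomp app [:h tagged t; tagged u]).
(** The identity serves as a fresh variable, placed last in the context when a term is applied to
    it. *)
Definition tone : term := pack (mid A).

Local Notation "t @ u" := (tapp t u) (at level 40, left associativity).

Lemma pack_capp (a b : mhom [::] A) : pack (capp app a b) = pack a @ pack b.
Proof. by []. Qed.

(** Turns representability into an equation between iterated applications to [tone], one for each
    argument. *)
Lemma pack_happ n (a : mhom [::] A) :
  pack (happ app a (ids A n)) = iter n (tapp^~ tone) (pack a).
Proof.
elim: n => [|n IH] /=; first exact: (happ0 app a).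
by rewrite -IH; apply: esym; apply: (happ_snoc app n a).
Qed.

Lemma pack_repr_op n (a : mhom [::] A) :
  pack (repr_op app n a) = iter n (tapp^~ tone) (pack a).
Proof. by rewrite -pack_happ; apply: castdomE. Qed.

Lemma repr_opP n (a : mhom [::] A) (f : mhom (nseq n A) A) :
  iter n (tapp^~ tone) (pack a) = pack f -> repr_op app n a = f.
Proof.
move=> H; apply: (heq_eq (hom := mhom)); exact: etrans (pack_repr_op n a) H.
Qed.

Variable L : abstraction.

Definition teta (t : term) : term := pack (mcomp (eta L) [:h tagged t]).

(** Agreement on a fresh variable also forces equal domains, since [Gam ++ [:: A]] determines [Gam];
    then [eta_ext] applies. *)
Lemma teta_ext t u : teta t = t -> teta u = u -> t @ tone = u @ tone -> t = u.
Proof.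
case: t u => [Gam x] [Gam' y] Ex Ey H.
have [/= e _] := heqP H.
have {}e : Gam = Gam' by move: e; rewrite !cats1 => /rcons_inj [].
destruct e; rewrite -Ex -Ey /teta /=.
by rewrite (eta_ext L (heq_eq H)).
Qed.

(** By associativity, [lam_beta] survives substituting [gs] for the context and [t] for the bound
    variable. *)
Lemma tapp_lam Gam (f : mhom (Gam ++ [:: A]) A) Gams (gs : hseq mhom Gams Gam)
    (t : term) :
  pack (mcomp (lam L f) gs) @ t = pack (mcomp f (hcat gs [:h tagged t])).
Proof.
rewrite -[in RHS](lam_beta L f).
apply: etrans (esym (mcompA2 app (lam L f) (mid A) gs [:h tagged t])).
apply: (mcomp2_heq app (erefl : mcomp (lam L f) gs =~= _)).
exact/esym/mcomp1f.
Qed.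

(** Substitution instances of abstractions stay fixed by eta; [B @ t] and [B @ t @ u] are of this
    form. *)
Lemma teta_lam Gam (f : mhom (Gam ++ [:: A]) A) Gams (gs : hseq mhom Gams Gam) :
  teta (pack (mcomp (lam L f) gs)) = pack (mcomp (lam L f) gs).
Proof.
apply: (etrans (esym (mcompA1 (eta L) (lam L f) gs))).
apply: mcomp_heq; [exact: eta_lam | exact: hcat0].
Qed.

Lemma pack_lam0 (f : mhom [:: A] A) :
  pack (mcomp (@lam L [::] f) hnil) = pack (lam L (Gam := [::]) f).
Proof. exact: (mcompf1 (lam L (Gam := [::]) f)). Qed.

Lemma teta_lam0 (f : mhom [:: A] A) :
  teta (pack (@lam L [::] f)) = pack (@lam L [::] f).
Proof. by rewrite -pack_lam0; apply: teta_lam. Qed.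

Lemma tapp_lam0 (f : mhom [:: A] A) (t : term) :
  pack (@lam L [::] f) @ t = pack (mcomp f [:h tagged t]).
Proof. by rewrite -pack_lam0; apply: tapp_lam. Qed.

(** In lambda notation: x y z |-> x (y z), then x |-> x, and x |-> x a. *)
Definition lamB : mhom [::] A :=
  @lam L [::] (@lam L [:: A] (@lam L [:: A; A] (mcomp app [:h mid A; app]))).
Definition lamI : mhom [::] A := @lam L [::] (mid A).
Definition lamdag (a : mhom [::] A) : mhom [::] A :=
  @lam L [::] (mcomp app [:h mid A; a]).

Local Notation B := (pack lamB).
Local Notation I := (pack lamI).

Lemma teta_B : teta B = B.
Proof. exact: teta_lam0. Qed.

Lemma teta_B1 t : teta (B @ t) = B @ t.
Proof. by rewrite tapp_lam0; apply: teta_lam. Qed.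

Lemma teta_B2 t u : teta (B @ t @ u) = B @ t @ u.
Proof. by rewrite tapp_lam0 tapp_lam; apply: teta_lam. Qed.

Lemma tapp_B t u v : B @ t @ u @ v = t @ (u @ v).
Proof.
rewrite tapp_lam0 tapp_lam tapp_lam /=.
apply: (etrans (mcompA2 app (mid A) app [:h tagged t] [:h tagged u; tagged v])).
by apply: (mcomp2_heq app) => //; apply: mcomp1f.
Qed.

Lemma teta_I : teta I = I.
Proof. exact: teta_lam0. Qed.

Lemma tapp_I t : I @ t = t.
Proof. by rewrite tapp_lam0; case: t => Gam x; apply: mcomp1f. Qed.

Lemma teta_dag a : teta (pack (lamdag a)) = pack (lamdag a).
Proof. exact: teta_lam0. Qed.

Lemma tapp_dag a t : pack (lamdag a) @ t = t @ pack a.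
Proof.
rewrite tapp_lam0; case: t => Gam x.
apply: (etrans (mcompA2 app (mid A) a [:h x] hnil)).
by apply: (mcomp2_heq app); [apply: mcomp1f | apply: (mcompf1 a)].
Qed.

Lemma repr_lamB : repr_op app 3 lamB = mcomp app [:h mid A; app].
Proof.
apply: repr_opP; rewrite /= tapp_B.
exact: (mcomp2_heq app (erefl : mid A =~= _) (mcompf1 app)).
Qed.

Lemma repr_lamI : repr_op app 1 lamI = mid A.
Proof. by apply: repr_opP; rewrite /= tapp_I. Qed.

Lemma repr_lamdag a : repr_op app 1 (lamdag a) = mcomp app [:h mid A; a].
Proof. by apply: repr_opP; rewrite /= tapp_dag. Qed.

Definition lam_combinators : combinators app :=
  Combinators repr_lamB repr_lamI repr_lamdag.

Lemma pack_inj Gam : injective (@pack Gam).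
Proof. move=> x y; exact: (heq_eq (hom := mhom)). Qed.

Definition tetaE := (teta_B, teta_B1, teta_B2, teta_I, teta_dag).
Definition tappE := (tapp_B, tapp_I, tapp_dag).

Lemma lam_axioms : lambda_axioms lam_combinators.
Proof.
split=> [||a|||a|a b]; apply: pack_inj; rewrite !pack_capp /=;
  (* Each round closes the goal by reduction or strips one abstraction; P.4, with four variables, is
     the longest case. *)
  do 4?[by rewrite ?tappE | apply: teta_ext; rewrite ?tappE ?tetaE //].
Qed.

Lemma pack_cstarnS n (f : term) :
  pack (cstarn lam_combinators lamB n.+1) @ f =
  pack (cstarn lam_combinators lamB n) @ (B @ f).
Proof. exact: (tapp_B (pack (cstarn lam_combinators lamB n)) B f). Qed.

(* For n+1, the hypothesis on f says that (B f)(t 1 .. 1) and (B f)(u 1 .. 1), with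
   n arguments, agree on 1, hence are equal: induct with B f for f. *)
Lemma cstarn_ext n (f t u : term) :
  f @ iter n (tapp^~ tone) t = f @ iter n (tapp^~ tone) u ->
  pack (cstarn lam_combinators lamB n) @ f @ t =
  pack (cstarn lam_combinators lamB n) @ f @ u.
Proof.
elim: n f => [|n IH] f H; first by rewrite !tapp_I.
rewrite !pack_cstarnS; apply: IH; apply: teta_ext; rewrite ?tetaE //.
by rewrite !tapp_B.
Qed.

Lemma lam_ext : weakly_multi_extensional lam_combinators.
Proof.
move=> a b n H; apply: pack_inj.
apply: (@cstarn_ext n I (pack a) (pack b)).
by rewrite -!pack_repr_op H.
Qed.

Lemma lam_computable n (f : mhom (nseq n A) A) : computable app f.
Proof.
suff [a Ha] : exists a : mhom [::] A, iter n (tapp^~ tone) (pack a) = pack f.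
  by exists a; apply: repr_opP.
elim: n f => [|n IH] f; first by exists f.
(* [lam] binds the last variable, so the last copy of [A] must be split off. *)
have e := esym (nseq_cat1 n A).
have [a Ha] := IH (lam L (castdom e f)).
by exists a; rewrite /= Ha /tapp lam_beta; apply: castdomE.
Qed.

Lemma lam_pca : planar_combinatory_algebra app.
Proof. by split=> *; apply: lam_computable. Qed.

Lemma lam_model : planar_lambda_model app.
Proof.
split; first exact: lam_pca.
by exists lam_combinators; split; [apply: lam_axioms | apply: lam_ext].
Qed.

End Abstraction.

(** * Abstraction in a semi-closed operad and in its idempotent splitting *)

Lemma curry_abstraction (N : multicategory) (A X : N) (e : X = A)
    (ev : mhom [:: X; A] A)
    (curry : forall Gam, mhom (Gam ++ [:: A]) A -> mhom Gam X) :
  (forall Gam (f : mhom (Gam ++ [:: A]) A),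
     mcomp ev [:h curry Gam f; mid A] = f) ->
  (forall Gam Gams (g : mhom (Gam ++ [:: A]) A) (fs : hseq mhom Gams Gam),
     curry (flatten Gams)
       (castdom (flatten_cat Gams [:: [:: A]]) (mcomp g (hcat fs [:h mid A]))) =
     mcomp (curry Gam g) fs) ->
  abstraction (ecast Y (mhom [:: Y; A] A) e ev).
Proof.
(* With [X] and [A] variables, the equality that will be [*, *] = * can be eliminated. *)
destruct e => /= beta nat.
(* Naturality at g = ev: Lam(ev o (x, 1)) = eta o x. Hence eta o x depends only on ev o (x, 1), and
   x = Lam(f) is fixed by beta. *)
have natE Gam (x : mhom Gam X) := nat [:: X] [:: Gam] ev [:h x].
apply: (@Abstraction _ _ _ curry (curry [:: X] ev)) => [//|Gam f|Gam x y H].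
  rewrite -natE /= beta.
  move: (flatten_cat _ _) => /=; rewrite cats0 => e.
  by rewrite (proof_irrelevance _ e erefl).
by rewrite -!natE /= H.
Qed.

(** [curry_ex] is a mere existence statement, hence [inhabited]. *)
Lemma op_ev_abstraction (M : operad) (C : semiclosed M) :
  inhabited (abstraction (op_ev C)).
Proof.
case: C => ihom ev [curry [beta nat]].
constructor; apply: (@curry_abstraction _ _ _ _ (ev star star)
  (fun Gam => curry Gam star star));
  [move=> Gam f; exact: beta | move=> Gam Gams g fs; exact: nat].
Qed.

(** Abstraction is inherited from M; the point is that it preserves split morphisms over every
    context [Gam]. *)
Lemma split_abstraction (M : operad) (C : semiclosed M) :
  abstraction (op_ev C) -> abstraction (split_ev C).
Proof.
move=> L; set S := split_star M.
have e Gam : map (@so_ob M) (Gam ++ [:: S]) = map (@so_ob M) Gam ++ [:: star].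
  by rewrite map_cat.
pose lamv Gam (f : split_hom (Gam ++ [:: S]) S) :=
  lam L (castdom (hom := mhom) (e Gam) (sval f)).
have beta Gam f : mcomp (op_ev C) [:h lamv Gam f; mid star] =~= sval f.
  by rewrite lam_beta; apply: castdomE.
have etav Gam f : mcomp (eta L) [:h lamv Gam f] =~= lamv Gam f by apply: eta_lam.
have ext Gam Gam' (x : mhom Gam star) (y : mhom Gam' star) : Gam = Gam' ->
    mcomp (op_ev C) [:h x; mid star] =~= mcomp (op_ev C) [:h y; mid star] ->
    mcomp (eta L) [:h x] =~= mcomp (eta L) [:h y].
  by move=> d; destruct d => H; rewrite (eta_ext L (heq_eq H)).
(* Absorption of the idempotents of [Gam] follows by extensionality: both sides are fixed by eta,
   and evaluating them at 1 gives f o (idems, 1) and f, equal because f is split. *)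
have lamP Gam f : @split_mor M Gam S (lamv Gam f).
  apply: split_homP; last exact: mcomp1f.
  have E := mcomp_heq (etav Gam f) (hcat0 (idems Gam)).
  apply: (etrans (esym E)); apply: etrans (etav Gam f).
  apply: (etrans (mcompA1 _ _ _)); apply: ext; first exact: flatten_seq1.
  apply: etrans (esym (beta Gam f)).
  apply: etrans (split_absr f).
  apply: etrans (mcomp_heq (beta Gam f) (esym (idems_cat Gam [:: S]))).
  apply: etrans (esym (mcompA2 _ _ _ (idems Gam) [:h mid star])).
  by apply: (mcomp2_heq (op_ev C)) => //; apply: esym; apply: mcomp1f.
have etaP : @split_mor M [:: S] S (eta L).
  by apply: split_homP; [apply: (mcompf1 (eta L)) | apply: mcomp1f].
refine (@Abstraction (Defs.split M) S (split_ev C)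
  (fun Gam f => exist (@split_mor M Gam S) (lamv Gam f) (lamP Gam f))
  (exist (@split_mor M [:: S] S) (eta L) etaP) _ _ _) => [Gam f|Gam f|Gam x y H].
- apply: (heq_eq (hom := @split_hom M)); apply: split_heq => //.
  by apply: (etrans (castdomE _ _)); apply: beta.
- apply: split_heq; first exact: cats0.
  by apply: (etrans (castdomE _ _)); apply: etav.
- apply: (heq_eq (hom := @split_hom M)); apply: split_heq => //.
  apply: (etrans (castdomE _ _)); apply: etrans (esym (castdomE _ _)).
  apply: ext => //.
  apply: (etrans (esym (castdomE (esym (map_flatten _ [:: Gam; [:: S]])) _))).
  apply: etrans (castdomE (esym (map_flatten _ [:: Gam; [:: S]])) _).
  exact: (f_equal (fun z => pack (sval z)) H).
Qed.

(** * Equality of morphisms up to domain and codomain *)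

Section Morphisms.
Variable M : multicategory.

(** Objects of an operad equal [star] only propositionally, so the codomain, which [=~=] keeps
    fixed, is packed too. *)
Definition packm (Gam : seq M) (B : M) (f : mhom Gam B) : mor M :=
  existT (fun p : seq M * M => mhom p.1 p.2) (Gam, B) f.

Definition mcast (Gam Gam' : seq M) (B B' : M) (e : Gam = Gam') (d : B = B')
    (f : mhom Gam B) : mhom Gam' B' :=
  ecast Y (mhom Gam' Y) d (castdom e f).

Lemma packm_mcast (Gam Gam' : seq M) (B B' : M) (e : Gam = Gam') (d : B = B')
    (f : mhom Gam B) :
  packm (mcast e d f) = packm f.
Proof. by destruct e, d. Qed.

Lemma packm_heq (Gam Gam' : seq M) (B : M) (f : mhom Gam B) (g : mhom Gam' B) :
  packm f = packm g <-> f =~= g.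
Proof.
split=> [|E].
  move=> /(@sigT_eqP _ (fun p : seq M * M => mhom p.1 p.2)
             (Gam, B) (Gam', B) f g) [e].
  case: (e) => d; destruct d.
  by rewrite (proof_irrelevance _ e erefl) => /= ->.
by have [e <-] := heqP E; destruct e.
Qed.

Lemma packm_eqP (Gam Gam' : seq M) (B B' : M) (f : mhom Gam B)
    (g : mhom Gam' B') :
  packm f = packm g -> exists (e : Gam = Gam') (d : B = B'), mcast e d f = g.
Proof.
move=> H.
have [/= E _] := sigT_eqP H; case: E => e d; destruct e, d.
exists erefl, erefl; apply: (heq_eq (hom := mhom)).
exact/packm_heq.
Qed.

Lemma packm_mcomp (As As' : seq M) (B B' : M) (f : mhom As B) (f' : mhom As' B')
    Gams Gams' (gs : hseq mhom Gams As) (gs' : hseq mhom Gams' As') :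
  packm f = packm f' -> hheq gs gs' -> packm (mcomp f gs) = packm (mcomp f' gs').
Proof.
move=> Hf Hg; have [e [d Hd]] := packm_eqP Hf; destruct d.
by apply/packm_heq; apply: mcomp_heq => //; apply/packm_heq.
Qed.

Lemma packm_hcons (Gam Gam' : seq M) (A A' : M) (g : mhom Gam A)
    (g' : mhom Gam' A') Gams Gams' As As'
    (gs : hseq mhom Gams As) (gs' : hseq mhom Gams' As') :
  packm g = packm g' -> hheq gs gs' -> hheq (hcons g gs) (hcons g' gs').
Proof.
move=> Hg Hgs; have [e [d Hd]] := packm_eqP Hg; destruct d.
by apply: hcons_mheq => //; apply/packm_heq.
Qed.

End Morphisms.

(** * The isomorphism between M and R *)

Section Isomorphism.
Variables (M : operad) (C : semiclosed M).
Hypothesis comp : forall n (f : mhom (nseq n (split_star M)) (split_star M)),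
  computable (split_ev C) f.
Variable pca : planar_combinatory_algebra (split_ev C).

Local Notation S := (split_star M).
Local Notation R := (R_operad pca).
Local Notation powS n := (map (@so_ob M) (nseq n S)).

(** The idempotent of [split_star] is the identity, so the splitting condition reduces to the unit
    laws. *)
Lemma split_mor_star n (f : mhom (powS n) (star : M)) :
  @split_mor M (nseq n S) S f.
Proof.
apply: split_homP; last exact: mcomp1f.
apply: etrans (mcompf1 f); apply: mcomp_heq => //.
by elim: n {f} => //= n IH; apply: hcons_hheq.
Qed.

Definition R_val (Gam : seq unit) B (f : R_hom (split_ev C) Gam B) : mor M :=
  packm (sval (sval f)).

(** Membership proofs are irrelevant, so the laws for R reduce to equations in M. *)
Lemma R_val_heq (Gam Gam' : seq unit) B (f : R_hom (split_ev C) Gam B)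
    (g : R_hom (split_ev C) Gam' B) :
  Gam = Gam' -> R_val f = R_val g -> f =~= g.
Proof.
move=> e H; destruct e; apply: R_heq => //; apply: split_heq => //.
exact/packm_heq.
Qed.

Lemma R_val_comp Gams (As : seq unit) B (f : R_hom (split_ev C) As B)
    (gs : hseq (@R_hom _ _ (split_ev C)) Gams As) :
  R_val (R_comp pca f gs) =
  packm (mcomp (sval (sval f)) (split_vals (R_vals gs))).
Proof.
rewrite /R_val /=.
set g := mcomp (sval f) (R_vals gs).
have E : castdom (flatten_nseq S Gams) g =~= g by apply: castdomE.
apply: etrans (f_equal (fun x : {Gam & split_hom Gam S} =>
  packm (sval (tagged x))) E) _.
by apply/packm_heq/castdomE.
Qed.

Lemma dom_to (Gam : seq M) : Gam = powS (size (map (fun=> tt) Gam)).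
Proof. by elim: Gam => //= A Gam {1}->; rewrite (starP A). Qed.

Lemma dom_from (Gam : seq unit) : powS (size Gam) = map (fun=> star) Gam.
Proof. by elim: Gam => //= A Gam ->. Qed.

Definition to_R (Gam : seq M) (B : M) (f : mhom Gam B) :
    R_hom (split_ev C) (map (fun=> tt) Gam) tt :=
  exist (@computable _ _ (split_ev C) _)
    (exist (@split_mor M (nseq _ S) S) _
       (split_mor_star (mcast (dom_to Gam) (starP B) f)))
    (comp _).

Definition from_R (Gam : seq unit) (B : unit) (f : R_hom (split_ev C) Gam B) :
    mhom (map (fun=> star) Gam) (star : M) :=
  castdom (dom_from Gam) (sval (sval f)).

Lemma R_val_to (Gam : seq M) (B : M) (f : mhom Gam B) :
  R_val (to_R f) = packm f.
Proof. exact: packm_mcast. Qed.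

Lemma packm_from (Gam : seq unit) (B : unit) (f : R_hom (split_ev C) Gam B) :
  packm (from_R f) = R_val f.
Proof. exact/packm_heq/castdomE. Qed.

Lemma to_R_id A : to_R (mid A) = R_id pca tt.
Proof.
apply: (heq_eq (hom := @R_hom _ _ (split_ev C))); apply: R_val_heq => //.
by rewrite R_val_to (starP A).
Qed.

Lemma to_R_comp Gams As B (f : mhom As B) (gs : hseq (@mhom M) Gams As) :
  to_R (mcomp f gs) =~= R_comp pca (to_R f) (hmap to_R gs).
Proof.
apply: R_val_heq; first exact: map_flatten.
rewrite R_val_to R_val_comp; apply: packm_mcomp.
  exact/esym/R_val_to.
elim: gs {f} => //= Gam A {}Gams {}As g gs IH.
by apply: packm_hcons => //; apply/esym/packm_mcast.
Qed.

Lemma from_R_id B : from_R (R_id pca B) = mid star.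
Proof.
by apply: (heq_eq (hom := mhom)); apply/packm_heq; rewrite packm_from.
Qed.

Lemma from_R_comp Gams As B (f : R_hom (split_ev C) As B)
    (gs : hseq (@R_hom _ _ (split_ev C)) Gams As) :
  from_R (R_comp pca f gs) =~= mcomp (from_R f) (hmap from_R gs).
Proof.
apply/packm_heq; rewrite packm_from R_val_comp; apply: packm_mcomp.
  exact/esym/packm_from.
elim: gs {f} => //= Gam A {}Gams {}As g gs IH.
by apply: packm_hcons => //; apply/esym/packm_from.
Qed.

Lemma from_RK (Gam : seq unit) (f : R_hom (split_ev C) Gam tt) :
  to_R (from_R f) =~= f.
Proof.
apply: R_val_heq; last by rewrite R_val_to packm_from.
by elim: Gam {f} => //= -[] Gam ->.
Qed.

Definition functor_to : mfunctor M R :=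
  @MFunctor M R (fun=> tt) to_R to_R_id to_R_comp.

Definition functor_from : mfunctor R M :=
  @MFunctor R M (fun=> star) from_R from_R_id from_R_comp.

Lemma R_isomorphic : isomorphic M R.
Proof.
exists functor_to, functor_from; split=> [A|[]|[[Gam B] f]|[[Gam B] f]] //.
- exact/esym/starP.
- exact: etrans (packm_from (to_R f)) (R_val_to f).
(* [from_RK] packs only the domain; the codomain [tt] is added back here. *)
- case: B f => f.
  exact: (f_equal (fun x : {G & R_hom (split_ev C) G tt} =>
    existT (fun p : seq R * R => mhom p.1 p.2) (tag x, tt) (tagged x))
    (from_RK f)).
Qed.

End Isomorphism.

Theorem theorem3 (M : operad) (C : semiclosed M) :
  exists h : planar_lambda_model (split_ev C),
    isomorphic M (R_operad (plm_pca h)).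
Proof.
have [/split_abstraction L] := op_ev_abstraction C.
(* Computability of all operations on [split_star] makes R exhaust M. *)
exists (lam_model L); apply: R_isomorphic => n f; exact: (lam_computable L).
Qed.
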